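(* Let $H$ be a division ring of finite dimension over its centre $h$, let $\alpha : G \rightarrow \mathrm{Gal}(L/H)$ be a finite embedding problem over $H$, and let $\mathcal{F}_H$ be the polynomial form with coefficients in $h$ associated with the reduced norm of $H/h$ relative to the choice of an $h$-basis of $H$. Then $\alpha$ has a solution $\mathrm{Gal}(F/H) \rightarrow G$ if and only if the finite embedding problem $\check{\alpha} : G \to \mathrm{Gal}(\ell/h)$ over $h$ has a solution $\mathrm{Gal}(f/h) \rightarrow G$ such that $\mathcal{F}_H$ has only the trivial zero over $f$.
   Context: A division ring is a nonzero (not necessarily commutative) ring in which every nonzero element is invertible; a field is a commutative division ring. An extension $L/H$ of division rings means that $H$ is a subring of $L$. $\mathrm{Aut}(L/H)$ is the group of automorphisms of $L$ fixing $H$ pointwise. $L/H$ is Galois (in the sense of Artin) if every element of $L$ fixed by all of $\mathrm{Aut}(L/H)$ lies in $H$; then $\mathrm{Gal}(L/H)=\mathrm{Aut}(L/H)$. Reduced norm form: let $[H:h]=n^2$, let $d \supseteq h$ be a splitting field of $H$ with an isomorphism of $d$-algebras $\phi : H\otimes_h d \to \mathcal{M}_n(d)$, and put $\mathrm{Nrd}_{H/h}(x)=\det(\phi(x\otimes 1))$, which lies in $h$ and is independent of $d$ and $\phi$. For an $h$-basis $e_1,\dots,e_{n^2}$ of $H$, $\mathcal{F}_H(x_1,\dots,x_{n^2}) = \mathrm{Nrd}_{H/h}(x_1e_1+\cdots+x_{n^2}e_{n^2})$, viewed as a polynomial in $h[x_1,\dots,x_{n^2}]$. It has only the trivial zero over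 a field $f\supseteq h$ if for $a\in f^{n^2}$, $\mathcal{F}_H(a)=0$ implies $a=0$. Known facts for $H$ finite-dimensional over its centre $h$: if $L/H$ is Galois with finite group and $\ell$ is the centre of $L$, then $h\subseteq \ell$, $\ell/h$ is finite Galois, and restriction $\mathrm{res}^{L/H}_{\ell/h}:\mathrm{Gal}(L/H)\to\mathrm{Gal}(\ell/h)$ is a well-defined isomorphism. If $L\subseteq F$ with $L/H$, $F/H$ Galois with finite groups, restriction $\mathrm{res}^{F/H}_{L/H}:\mathrm{Gal}(F/H)\to \mathrm{Gal}(L/H)$ is well defined. Let $K$ be a division ring finite-dimensional over its centre (possibly a field). A finite embedding problem over $K$ is an epimorphism $\alpha:G\to\mathrm{Gal}(L/K)$ with $G$ a finite group and $L/K$ a Galois extension. A solution to $\alpha$ is an isomorphism $\beta : \mathrm{Gal}(F/K)\to G$, where $F/K$ is Galois with $L\subseteq F$, such that $\alpha\circ\beta=\mathrm{res}^{F/K}_{L/K}$. (If $K$ is commutative, $L$ and $F$ are automatically commutative.) For $\alpha:G\to\mathrm{Gal}(L/H)$ a finite embedding problem over $H$, with $\ell$ the centre of $L$, $\check{\alpha}=\mathrm{res}^{L/H}_{\ell/h}\circ\alpha : G\to\mathrm{Gal}(\ell/h)$. *)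

(* Defs.v *)
From HB Require Import structures.
From mathcomp Require Import all_boot all_algebra fingroup.
From mathcomp Require Import boolp.
From mathcomp Require Import mpoly.

Set Implicit Arguments.
Unset Strict Implicit.
Unset Printing Implicit Defensive.

Import GRing.Theory.
Local Open Scope ring_scope.

(** * Division rings and their centres *)

HB.mixin Record UnitRing_isDivisionRing R of GRing.UnitRing R := {
  divr_unit : forall x : R, x != 0 -> x \is a GRing.unit
}.

#[short(type="divRingType")]
HB.structure Definition DivisionRing :=
  {R of UnitRing_isDivisionRing R & GRing.UnitRing R}.

Definition central {D : divRingType} : {pred D} :=
  fun x => `[< forall y : D, x * y = y * x >].

Record centre (D : divRingType) :=
  Centre { centre_val : D; _ : centre_val \in central }.

Section Centre.
Variable D : divRingType.

Lemma centralP (x : D) : reflect (forall y, x * y = y * x) (x \in central).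
Proof. exact: asboolP. Qed.

Fact central_divring_closed : divring_closed (@central D).
Proof.
split=> [|x y /centralP cx /centralP cy|x y /centralP cx /centralP cy].
- by apply/centralP => y; rewrite mulr1 mul1r.
- by apply/centralP => z; rewrite mulrBl mulrBr cx cy.
apply/centralP => z.
have cyV : z * y^-1 = y^-1 * z by apply: commrV; rewrite /GRing.comm cy.
by rewrite -mulrA -cyV mulrA cx mulrA.
Qed.

HB.instance Definition _ :=
  GRing.isDivringClosed.Build D central central_divring_closed.

HB.instance Definition _ := [isSub of centre D for @centre_val D].
HB.instance Definition _ := [Choice of centre D by <:].
HB.instance Definition _ := [SubChoice_isSubUnitRing of centre D by <:].

Fact centre_mulC : commutative (@GRing.mul (centre D)).
Proof.
by move=> x y; apply: val_inj; rewrite !rmorphM; apply: (centralP _ (valP x)).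
Qed.

HB.instance Definition _ :=
  GRing.PzRing_hasCommutativeMul.Build (centre D) centre_mulC.

Fact centre_fieldP : GRing.field_axiom (centre D).
Proof.
move=> x x0; have ux : \val x \is a GRing.unit by apply: divr_unit.
have xV : \val x * (\val x)^-1 = 1 by apply: divrr.
have cV : (\val x)^-1 \in @central D by rewrite rpredV (valP x).
apply/unitrP; exists (Centre cV).
by split; apply: val_inj; rewrite rmorphM rmorph1 /= ?mulVr.
Qed.

HB.instance Definition _ :=
  GRing.ComUnitRing_isField.Build (centre D) centre_fieldP.

End Centre.

(** * Extensions, relative automorphism groups, Galois extensions

    An extension L/K is given by the map [i : K -> L] which identifies K with
    a subring of L; that [i] is a ring morphism is part of [galois]. *)

Definition is_relAut (K L : nzRingType) (i : K -> L) (s : L -> L) : Prop :=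
  [/\ zmod_morphism s, monoid_morphism s, bijective s
    & forall x : K, s (i x) = i x].

Record relAut (K L : nzRingType) (i : K -> L) :=
  RelAut { relAut_val :> L -> L; relAutP : is_relAut i relAut_val }.

Section RelAut.
Variables (K L : nzRingType) (i : K -> L).
Implicit Types s t : relAut i.

HB.instance Definition _ := gen_eqMixin (relAut i).
HB.instance Definition _ := gen_choiceMixin (relAut i).

Lemma relAut_inj s t : s =1 t -> s = t.
Proof.
case: s t => [s sP] [t tP] /= st.
have {}st : s = t by apply: funext.
by subst t; rewrite (Prop_irrelevance sP tP).
Qed.

Fact relAut1P : is_relAut i (@id L).
Proof. by split=> //; exists id. Qed.

Fact relAutMP s t : is_relAut i (s \o t).
Proof.
have [sB [s1 sM] sbij si] := relAutP s; have [tB [t1 tM] tbij ti] := relAutP t.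
split=> [x y||| x] /=; first by rewrite tB sB.
- by split=> [|x y] /=; rewrite ?t1 ?s1 // tM sM.
- exact: bij_comp.
- by rewrite ti si.
Qed.

Fact relAutV_ex s : exists t : relAut i, cancel t s.
Proof.
have [sB [s1 sM] [t sK tK] si] := relAutP s.
have tP : is_relAut i t.
  split=> [x y||| x].
  - by rewrite -{1}[x]tK -{1}[y]tK -sB sK.
  - split=> [|x y]; first by rewrite -{1}s1 sK.
    by rewrite -{1}[x]tK -{1}[y]tK -sM sK.
  - by exists s.
  - by rewrite -{1}(si x) sK.
by exists (RelAut tP).
Qed.

Definition relAut1 := RelAut relAut1P.
Definition relAutM s t := RelAut (relAutMP s t).
Definition relAutV s := projT1 (cid (relAutV_ex s)).

Fact relAut_mulA : associative relAutM.
Proof. by move=> s t u; apply: relAut_inj. Qed.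

Fact relAut_mul1 : left_id relAut1 relAutM.
Proof. by move=> s; apply: relAut_inj. Qed.

Fact relAut_mulr1 : right_id relAut1 relAutM.
Proof. by move=> s; apply: relAut_inj. Qed.

Fact relAut_mulrV : right_inverse relAut1 relAutV relAutM.
Proof.
by move=> s; apply: relAut_inj => x /=; rewrite /relAutV; case: cid => t /= ->.
Qed.

Fact relAut_mulV : left_inverse relAut1 relAutV relAutM.
Proof.
move=> s; apply: relAut_inj => x /=.
have [_ _ /bij_inj s_inj _] := relAutP s.
by apply: s_inj; rewrite /relAutV; case: cid => t /= ->.
Qed.

HB.instance Definition _ := isGroup.Build (relAut i)
  relAut_mulA relAut_mul1 relAut_mulr1 relAut_mulV relAut_mulrV.

(** Galois in the sense of Artin; then Gal(L/K) is [relAut i]. *)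
Definition galois : Prop :=
  [/\ zmod_morphism i, monoid_morphism i
    & forall y : L, (forall s : relAut i, s y = y) -> exists x : K, y = i x].

End RelAut.

(** * Finite embedding problems *)

Definition embedding_problem (K L : nzRingType) (i : K -> L)
    (G : finGroupType) (alpha : G -> relAut i) : Prop :=
  [/\ galois i, {morph alpha : g g' / (g * g')%g}
    & forall s : relAut i, exists g : G, alpha g = s].

(** [k : L -> F] is the inclusion of L into F, so that F/K is given by
    [k \o i].  The last clause says that (alpha \o beta) s is the restriction
    of s to L. *)
Definition solution (K L F : nzRingType) (i : K -> L) (G : finGroupType)
    (alpha : G -> relAut i) (k : L -> F) (beta : relAut (k \o i) -> G) : Prop :=
  [/\ galois (k \o i), {morph beta : s t / (s * t)%g}, bijective beta
    & forall (s : relAut (k \o i)) (x : L), k (alpha (beta s) x) = s (k x)].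

(** * Passing to the centres *)

Section Check.
Variables (H L : divRingType) (i : H -> L).

(** The inclusion of the centre h of H into the centre l of L.  The default
    value 0 of [insubd] is never used when H is finite-dimensional over h and
    L/H is Galois with finite group, since then h is contained in l. *)
Definition centre_map (x : centre H) : centre L := insubd 0 (i (\val x)).

Fact relAut_central (s : relAut i) (z : centre L) : s (\val z) \in @central L.
Proof.
have [_ [_ sM] [t sK tK] _] := relAutP s.
apply/centralP => y; rewrite -(tK y) -!sM; congr (s _).
exact: (centralP _ (valP z)).
Qed.

Definition res_centre_fun (s : relAut i) (z : centre L) : centre L :=
  Centre (relAut_central s z).

Fact res_centreP (s : relAut i) : is_relAut centre_map (res_centre_fun s).
Proof.
have [sB [s1 sM] sbij si] := relAutP s.
have [t tK] := relAutV_ex s.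
split=> [x y||| x].
- by apply: val_inj; rewrite /= sB.
- by split=> [|x y]; apply: val_inj; rewrite /= ?s1 ?sM.
- exists (fun z => Centre (relAut_central t z)) => z; apply: val_inj => /=.
    by apply: (bij_inj sbij); rewrite tK.
  by rewrite tK.
- apply: val_inj; rewrite /= /centre_map /insubd.
  case: insubP => [u _ /= ->|_ /=]; first by rewrite si.
  by have := sB 0 0; rewrite !subrr.
Qed.

(** The restriction map from Gal(L/H) to Gal(l/h). *)
Definition res_centre (s : relAut i) : relAut centre_map :=
  RelAut (res_centreP s).

Definition check (G : finGroupType) (alpha : G -> relAut i) :
  G -> relAut centre_map := res_centre \o alpha.

End Check.

(** * The reduced norm form *)

Definition centre_basis (H : divRingType) (m : nat) (e : 'I_m -> H) : Prop :=
  forall y : H, exists! x : 'rV[centre H]_m, y = \sum_k \val (x 0 k) * e k.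

(** Biadditive maps on H x d that are balanced over h = [centre H], where d is
    an h-algebra via [eta]. *)
Definition balanced (H : divRingType) (d : fieldType) (eta : centre H -> d)
    (A : zmodType) (b : H -> d -> A) : Prop :=
  [/\ forall x y s, b (x + y) s = b x s + b y s,
      forall x s t, b x (s + t) = b x s + b x t
    & forall x c s, b (x * \val c) s = b x (eta c * s)].

(** The d-algebra morphism phi on the tensor product of H and d over h, with
    values in M_n(d), is determined by [psi x] = phi(x (x) 1), namely
    phi(x (x) s) = s psi(x).  That phi is well defined and bijective is
    expressed by the universal property of the tensor product: (x, s) |->
    s psi(x) is the universal balanced map. *)
Definition splitting (H : divRingType) (d : fieldType) (eta : centre H -> d)
    (n : nat) (psi : H -> 'M[d]_n) : Prop :=
  balanced eta (fun x s => s *: psi x) /\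
  forall (A : zmodType) (b : H -> d -> A), balanced eta b ->
    exists! g : 'M[d]_n -> A,
      zmod_morphism g /\ forall x s, g (s *: psi x) = b x s.

(** [F] is the reduced norm det (phi (x (x) 1)) of the generic element
    x = 'X_0 e_0 + ... + 'X_(m-1) e_(m-1), computed over some splitting field
    d; the equation of polynomials over d determines [F].  The universal
    property in [splitting] forces m = n ^ 2 when [e] is a basis. *)
Definition reduced_norm_form (H : divRingType) (m : nat) (e : 'I_m -> H)
    (F : {mpoly (centre H)[m]}) : Prop :=
  exists (n : nat) (d : fieldType) (eta : {rmorphism centre H -> d})
         (psi : {rmorphism H -> 'M[d]_n}),
    splitting eta psi /\
    map_mpoly eta F = \det (\sum_k 'X_k *: map_mx (@mpolyC m d) (psi (e k))).

Definition only_trivial_zero (h f : fieldType) (j : h -> f) (m : nat)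
    (F : {mpoly h[m]}) : Prop :=
  forall a : 'I_m -> f, mmap j a F = 0 -> forall k, a k = 0.

(* Main.v *)
Require Import Defs.
From mathcomp Require Import all_boot all_algebra fingroup.
From mathcomp Require Import mpoly.
From HB Require Import structures.
From mathcomp Require Import cyclic finfield.
From mathcomp Require Import boolp classical_sets cardinality.

Set Implicit Arguments.
Unset Strict Implicit.
Unset Printing Implicit Defensive.

Import GRing.Theory.
Local Open Scope ring_scope.

(** Write h for the centre of H.  The theorem holds because an extension L/H of
    division rings with finite automorphism group is a base change of H: it is
    the tensor product over h of H and the centre l of L, and passing from l/h
    to L/H or back loses no automorphisms.

    Base change.  [base_change e i z j] says that L is H tensored with l over
    h, in terms of a basis e of H/h.  Two facts make it a dictionary between
    extensions of H and extensions of h.  It is functorial in l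
    ([base_change_map]), and the centraliser of H in L is l
    ([base_change_centraliser]); hence an automorphism of L/H restricts to l,
    an automorphism of l/h extends uniquely to L, so that Aut(L/H) = Aut(l/h)
    ([base_change_aut]), and L/H is Galois exactly when l/h is
    ([galois_base_change]).

    Finitely many automorphisms force a base change
    ([finite_aut_base_change]).  Conjugation by a nonzero element of the
    centraliser C of H in L is an automorphism of L/H, trivial only if the
    element is central, so that the nonzero elements of C fall into finitely
    many classes modulo the centre of L.  If the centre is infinite this gives
    C = l at once; otherwise C, then h, H and finally L are finite, and L is
    commutative by Wedderburn's theorem ([centraliser_central]).  Since h lies
    in C, it is central in L, and the coordinate functions of H/h, being sums
    of maps y |-> a y b ([coord_sandwich]), make sense on all of L; there they
    take values in C = l and split L as the direct sum of the l e_k.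

    Norm.  For an extension f of h, the tensor product of H and f is the span
    of the right multiplication matrices of H in M_m(f) ([scalar_ext]), and it
    is a division ring exactly when every nonzero combination of these matrices
    is invertible.  By [reduced_norm_regular] the determinant of such a
    combination is a power of the value of the reduced norm form, so that the
    condition is that the form has only the trivial zero over f
    ([base_change_trivial_zero], [base_change_division_ex]).

    A solution F over H thus yields the solution Z(F) over h, and a solution f
    over h for which the form is anisotropic yields the division ring obtained
    from H by base change to f. *)

(** * Finite division rings *)

Section FiniteDivisionRings.
Local Open Scope classical_set_scope.

Lemma finite_set_enum (T : choiceType) : finite_set [set: T] ->
  exists2 s : seq T, Finite.axiom s & forall x0, cancel (index^~ s) (nth x0 s).
Proof.
move=> /finite_seqP[s sE].
have mem_s x : x \in undup s.
  by rewrite mem_undup; have : [set: T] x by []; rewrite sE => /= ->.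
exists (undup s) => [x|x0 x]; last exact: nth_index.
by rewrite count_uniq_mem ?undup_uniq // mem_s.
Qed.

Lemma finite_divring_mulC (D : divRingType) :
  finite_set [set: D] -> commutative (@GRing.mul D).
Proof.
move=> /finite_set_enum[s sP /(_ 0) sK].
pose fR : finUnitRingType :=
  HB.pack D (CanIsCountable sK) (isFinite.Build D sP).
apply: (@finDomain_mulrC fR) => x y xy0.
have [//|x0] := eqVneq x 0.
apply/eqP; apply: (mulrI (divr_unit x x0)).
by rewrite mulr0.
Qed.

Lemma finite_field_generator (F : fieldType) : finite_set [set: F] ->
  exists n (g : F), n.-primitive_root g /\
    forall x, x != 0 -> exists k, x = g ^+ k.
Proof.
move=> /finite_set_enum[s sP /(_ 0) sK].
pose fF : finFieldType :=
  HB.pack F (CanIsCountable sK) (isFinite.Build F sP).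
pose rs := [seq x <- enum fF | x != 0].
have rs1 : all #|fF|.-1.-unity_root rs.
  apply/allP => x; rewrite mem_filter => /andP[x0 _].
  rewrite unity_rootE; apply/eqP; apply: (mulfI x0); rewrite -exprS mulr1.
  by rewrite prednK ?expf_card // (cardD1 0) inE.
have szrs : size rs = #|fF|.-1.
  have := cardC1 (0 : fF); rewrite cardE => <-.
  rewrite /rs /enum_mem -filter_predI; congr size.
  by apply: eq_filter => x /=; rewrite !inE andbT.
have n0 : (0 < #|fF|.-1)%N by have := finNzRing_gt1 fF; case: #|_| => [|[]].
have [||g g_rs pg] := hasP (has_prim_root n0 rs1 _ _).
- by rewrite filter_uniq ?enum_uniq.
- by rewrite szrs.
exists #|fF|.-1, g; split=> // x x0.
have /(prim_rootP pg)[k ->] : (x : fF) ^+ #|fF|.-1 = 1.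
  apply/eqP; rewrite -unity_rootE; apply: (allP rs1).
  by rewrite mem_filter x0 mem_enum.
by exists k.
Qed.

Lemma finite_sumset (V : zmodType) (A : nat -> set V) (n : nat) :
  (forall j, finite_set (A j)) ->
  finite_set
    [set \sum_(j < n) v j | v in [set v : nat -> V | forall j, A j (v j)]].
Proof.
move=> Afin; elim: n => [|n IHn].
  apply: sub_finite_set (finite_set1 0) => _ [v _ <-] /=.
  by rewrite big_ord0.
apply: sub_finite_set (finite_image2 +%R IHn (Afin n)) => _ [v Av <-] /=.
by exists (\sum_(j < n) v j); [exists v | exists (v n); rewrite ?big_ord_recr].
Qed.

Lemma divr_neq0 (D : divRingType) (x y : D) : x != 0 -> y != 0 -> x * y != 0.
Proof.
move=> /divr_unit ux /divr_unit uy; apply/eqP => xy0.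
by have := unitrMl x uy; rewrite xy0 unitr0 ux.
Qed.

(** Conjugation by g has order dividing n, and the powers of g contain all its
    possible eigenvalues, so that every element of D is a sum of eigenvectors:
    up to the invertible factor n, y is the sum over j of its projections to
    the sets [A j] of all y with g y = g^j y g.  The quotient of two nonzero
    elements of [A j] commutes with g, hence each [A j] is finite. *)
Lemma finite_of_centraliser (D : divRingType) (g : D) (n : nat) :
    g ^+ n = 1 -> (forall k, (0 < k < n)%N -> g ^+ k != 1) -> n%:R != 0 :> D ->
    finite_set [set y | g * y = y * g] -> finite_set [set: D].
Proof.
case: n => [|n] gn1 g_prim n_neq0 fin_cent; first by rewrite eqxx in n_neq0.
have ug : g \is a GRing.unit.
  by apply/unitrP; exists (g ^+ n); rewrite -exprS -exprSr.
pose A j : set D := [set y | g * y = g ^+ j * y * g].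
have Afin j : finite_set (A j).
  have [[y0 [Ay0 y0_neq0]]|noA] := pselect (exists y0, A j y0 /\ y0 != 0).
    apply: sub_finite_set (finite_image ( *%R y0) fin_cent) => y Ay /=.
    have uy0 := divr_unit y0 y0_neq0.
    exists (y0^-1 * y); last by rewrite mulrA divrr ?mul1r.
    have ugy0 : g ^+ j * y0 \is a GRing.unit by rewrite unitrMl ?unitrX.
    apply: (mulrI ugy0); rewrite mulrA -Ay0 -!mulrA !(mulVKr uy0, mulKr uy0).
    by rewrite mulrA.
  apply: sub_finite_set (finite_set1 0) => y Ay /=.
  by apply: contrapT => /eqP y0; case: noA; exists y.
(* [p y j] averages y along the cyclic group generated by g, twisted by the
   character g |-> g^j; multiplying by g permutes its terms cyclically. *)
pose t y j i := g^-1 ^+ (i * j) * g ^+ i * y * g^-1 ^+ i.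
pose p y j := \sum_(i < n.+1) t y j i.
have gV k : g^-1 ^+ k = (g ^+ k)^-1 by rewrite exprVn.
have Ap y j : A j (p y j).
  have tS i : g * t y j i = g ^+ j * t y j i.+1 * g.
    rewrite /t mulSn exprD !gV !mulrA divrr ?unitrX // mul1r.
    have cg : g * (g ^+ (i * j))^-1 = (g ^+ (i * j))^-1 * g.
      by apply: commrV; apply: commrX.
    rewrite cg -(mulrA _ g) -exprS -!mulrA; do 3 congr (_ * _).
    by rewrite exprS invrM ?unitrX // -mulrA mulVr ?mulr1.
  rewrite /A /= /p mulr_sumr.
  rewrite (eq_bigr (fun i : 'I_n.+1 => g ^+ j * t y j i.+1 * g)) //.
  rewrite -mulr_suml -mulr_sumr.
  congr (_ * _ * _).
  rewrite big_ord_recr big_ord_recl /= addrC; congr (_ + _).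
  by rewrite /t !gV mul0n !expr0 exprM gn1 expr1n.
(* Orthogonality: only the i = 0 terms survive summation over j. *)
have sum_p y : \sum_(j < n.+1) p y j = n.+1%:R * y.
  rewrite /p exchange_big /=.
  rewrite big_ord_recl /= [X in _ + X]big1 => [|i _].
    rewrite addr0 /t (eq_bigr (fun=> y)) => [|j _].
      by rewrite sumr_const card_ord mulr_natl.
    by rewrite mul0n !expr0 !mul1r mulr1.
  rewrite -[RHS](mul0r (y * g^-1 ^+ i.+1)) -[in RHS](mul0r (g ^+ i.+1)).
  rewrite !mulrA /t /bump /= add1n -!mulr_suml; congr (_ * _ * _ * _).
  pose w := g^-1 ^+ i.+1.
  have w1 : w != 1.
    have := g_prim i.+1; rewrite /= ltnS ltn_ord => /(_ isT).
    apply: contraNneq; rewrite /w gV => /(congr1 GRing.inv).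
    by rewrite invrK invr1 => ->.
  have uw1 : w - 1 \is a GRing.unit by apply: divr_unit; rewrite subr_eq0.
  apply: (mulrI uw1); rewrite mulr0.
  transitivity (w ^+ n.+1 - 1).
    rewrite [RHS]subrX1; congr (_ * _); apply: eq_bigr => j _.
    by rewrite exprM.
  by rewrite /w gV -exprVn -exprM mulnC exprM exprVn gn1 invr1 expr1n subrr.
apply: sub_finite_set (finite_image ( *%R n.+1%:R^-1) (finite_sumset n.+1 Afin)).
move=> y _ /=; exists (n.+1%:R * y); last by rewrite mulKr ?divr_unit.
by exists (p y).
Qed.
End FiniteDivisionRings.

(** * Extensions with finitely many automorphisms *)

Section Centraliser.
Local Open Scope classical_set_scope.
Variables (H L : divRingType) (i : {rmorphism H -> L}).

Definition centraliser : set L := [set y | forall x, y * i x = i x * y].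

Lemma inner_relAut c : centraliser c -> c != 0 ->
  exists s : relAut i, forall y, s y = c * y * c^-1.
Proof.
move=> Cc /divr_unit uc.
have sP : is_relAut i (fun y => c * y * c^-1).
  split=> [x y||| x].
  - by rewrite mulrBr mulrBl.
  - split=> [|x y]; first by rewrite mulr1 divrr.
    by rewrite !mulrA mulrVK.
  - exists (fun y => c^-1 * y * c) => y.
      by rewrite !mulrA mulVr // mul1r mulrVK.
    by rewrite !mulrA divrr // mul1r mulrK.
  - by rewrite Cc mulrK.
by exists (RelAut sP).
Qed.

(** Let c centralise H without being central in L.  Two elements of the
    centraliser that induce the same inner automorphism differ by a central
    factor, and there are finitely many inner automorphisms.  If a and b are
    distinct and central, then c + a and c + b do not differ by such a factor,
    as c would be central; so the centre of L is finite, and with it the whole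
    centraliser.  The latter contains the centre of H, so that H is finite, hence
    a field by Wedderburn's theorem, and generated by a root of unity g.  The
    centraliser of g in L is that of H; it is finite, which makes L finite,
    hence commutative: a contradiction. *)
Lemma centraliser_central (m : nat) (e : 'I_m -> H) (e_basis : centre_basis e)
    (G : finType) (alpha : G -> relAut i)
    (alpha_surj : forall s, exists g, alpha g = s) c :
  centraliser c -> c \in @central L.
Proof.
move=> Cc; apply: contrapT => c_notin.
have CD : forall x y, centraliser x -> centraliser y -> centraliser (x + y).
  by move=> x y Cx Cy z; rewrite mulrDl mulrDr Cx Cy.
have Cl a : a \in @central L -> centraliser a by move=> /centralP al x; apply: al.
pose R (g : G) d := [/\ centraliser d, d != 0 & forall y, alpha g y = d * y * d^-1].
have R_ex d : centraliser d -> d != 0 -> exists g, R g d.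
  move=> Cd d0; have [s sE] := inner_relAut Cd d0; have [g gs] := alpha_surj s.
  by exists g; split=> // y; rewrite gs.
have R_fib g d d' : R g d -> R g d' -> d^-1 * d' \in @central L.
  case=> _ /divr_unit ud dE [_ /divr_unit ud' d'E]; apply/centralP => y.
  have /(congr1 (fun z => d^-1 * z * d')) : d * y * d^-1 = d' * y * d'^-1.
    by rewrite -dE d'E.
  by rewrite !mulrA mulVr // mul1r mulrVK.
have fin_l : finite_set [set a | a \in @central L].
  pose A g := [set a | a \in @central L /\ R g (c + a)].
  apply: (@sub_finite_set _ _ (\bigcup_(g in [set: G]) A g)).
    move=> a /= al; have [|g Rg] := R_ex (c + a) (CD _ _ Cc (Cl _ al)).
      apply: contra_notN c_notin => /eqP/(canRL (addrK a)).
      by rewrite sub0r => ->; rewrite rpredN.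
    by exists g.
  apply: bigcup_finite => [|g _]; first exact: finite_finset.
  have [[a0 Aa0]|noA] := pselect (exists a, A g a); last first.
    by apply: sub_finite_set (finite_set0 L) => a Aa; case: noA; exists a.
  apply: sub_finite_set (finite_set1 a0) => a [al Rga] /=; case: Aa0 => al0 Rga0.
  have := R_fib _ _ _ Rga0 Rga; set z := _ * _ => zl.
  have u0 : c + a0 \is a GRing.unit by apply: divr_unit; case: Rga0.
  have ca : c + a = (c + a0) * z by rewrite mulVKr.
  apply: contrapT => aa0; apply: c_notin.
  have z1 : 1 - z != 0.
    apply: contra_not_neq aa0 => /eqP; rewrite subr_eq0 => /eqP z1; move: ca.
    by rewrite -z1 mulr1 => /addrI.
  have -> : c = (a0 * z - a) / (1 - z).
    apply: (mulIr (divr_unit _ z1)); rewrite mulrVK ?divr_unit //.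
    rewrite mulrBr mulr1; apply/eqP; rewrite subr_eq addrAC eq_sym subr_eq.
    by rewrite ca mulrDl addrC.
  apply: rpred_div; first by apply: rpredB => //; apply: rpredM.
  by apply: rpredB => //; apply: rpred1.
have fin_C : finite_set centraliser.
  pose A g := [set d | R g d].
  apply: (@sub_finite_set _ _ ([set 0] `|` \bigcup_(g in [set: G]) A g)).
    move=> d Cd; have [->|d0] := eqVneq d 0; first by left.
    by right; have [g Rg] := R_ex d Cd d0; exists g.
  rewrite finite_setU; split; first exact: finite_set1.
  apply: bigcup_finite => [|g _]; first exact: finite_finset.
  have [[d0 Ad0]|noA] := pselect (exists a, A g a); last first.
    by apply: sub_finite_set (finite_set0 L) => a Aa; case: noA; exists a.
  apply: sub_finite_set (finite_image ( *%R d0) fin_l) => d Ad /=.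
  exists (d0^-1 * d); first exact: R_fib Ad0 Ad.
  by rewrite mulVKr //; apply: divr_unit; case: Ad0.
pose iv := i \o \val : {rmorphism centre H -> L}.
have fin_h : finite_set [set: centre H].
  apply: sub_finite_set (finite_preimage (in2W (fmorph_inj iv)) fin_C).
  by move=> x _ y; rewrite /iv /= -!(rmorphM i) (centralP _ (valP x)).
have fin_H : finite_set [set: H].
  pose A j := [set \val x * oapp e 0 (insub j) | x in [set: centre H]].
  apply: sub_finite_set (@finite_sumset _ A m _) => [y _|j]; last first.
    exact: finite_image.
  have [v [-> _]] := e_basis y.
  exists (fun j => \val (oapp (v 0) 0 (insub j)) * oapp e 0 (insub j)).
    by move=> j /=; exists (oapp (v 0) 0 (insub j)).
  by apply: eq_bigr => k _; rewrite valK.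
have H_comm := finite_divring_mulC fin_H.
have [n [g [pg g_gen]]] := finite_field_generator fin_h.
suff fin_L : finite_set [set: L].
  by apply: c_notin; apply/centralP => y; apply: finite_divring_mulC.
apply: (@finite_of_centraliser _ (iv g) n).
- by rewrite -rmorphXn (prim_expr_order pg) rmorph1.
- move=> k /andP[k0 kn]; rewrite -rmorphXn fmorph_eq1 -(prim_order_dvd pg).
  by rewrite gtnNdvd.
- by rewrite -(rmorph_nat iv) fmorph_eq0 (prim_root_natf_neq0 pg).
apply: sub_finite_set fin_C => y /= gy x.
have xl : x \in @central H by apply/centralP => x'; apply: H_comm.
have [->|x0] := eqVneq x 0; first by rewrite rmorph0 mulr0 mul0r.
have [|k xE] := g_gen (Centre xl).
  by rewrite -(inj_eq val_inj) rmorph0.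
have -> : i x = iv g ^+ k by rewrite -rmorphXn -xE.
by apply/esym/commr_sym/commrX/commr_sym.
Qed.
End Centraliser.

(** * Coordinates as sums of two-sided multiplications *)

Section Basis.
Variables (H : divRingType) (m : nat) (e : 'I_m -> H).
Hypothesis e_basis : centre_basis e.

Definition coord (y : H) : 'rV[centre H]_m := projT1 (cid (e_basis y)).

Lemma coordK y : \sum_k \val (coord y 0 k) * e k = y.
Proof. by rewrite /coord; case: cid => v /= [<-]. Qed.

Lemma coord_eq (v : 'rV[centre H]_m) : coord (\sum_k \val (v 0 k) * e k) = v.
Proof. by rewrite /coord; case: cid => w /= [_]; apply. Qed.

Fact coord_zmod_morphism : zmod_morphism coord.
Proof.
move=> x y; rewrite -{1}[x]coordK -{1}[y]coordK -sumrB -[RHS]coord_eq.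
congr coord; apply: eq_bigr => k _.
by rewrite !mxE rmorphB mulrBl.
Qed.

HB.instance Definition _ :=
  GRing.isZmodMorphism.Build H 'rV[centre H]_m coord coord_zmod_morphism.

Lemma coordZ c y : coord (\val c * y) = c *: coord y.
Proof.
rewrite -{1}[y]coordK mulr_sumr -[RHS]coord_eq; congr coord.
by apply: eq_bigr => k _; rewrite !mxE rmorphM mulrA.
Qed.

Lemma coord_basis k : coord (e k) = delta_mx 0 k.
Proof.
rewrite -[RHS]coord_eq; congr coord; rewrite (bigD1 k) //= big1 => [|r rk].
  by rewrite mxE !eqxx rmorph1 mul1r addr0.
by rewrite mxE (negPf rk) andbF rmorph0 mul0r.
Qed.

(** A relation with the fewest nonzero d_p, scaled so that one of them is 1,
    has all its d_p central: replacing y by y z and subtracting the relation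
    multiplied by z on the right gives a shorter one.  At y = 1 it then
    contradicts the independence of the e_p over the centre. *)
Lemma basis_sandwich_free (d : 'I_m -> H) :
  (forall y, \sum_p e p * y * d p = 0) -> forall p, d p = 0.
Proof.
have [n] := ubnP #|[set p | d p != 0]|.
elim: n d => // n IHn d lt_n rel p0; apply: contrapT => /eqP dp0.
pose d1 p := d p / d p0.
have rel1 y : \sum_p e p * y * d1 p = 0.
  have := congr1 ( *%R^~ (d p0)^-1) (rel y).
  rewrite /= mul0r mulr_suml => d_rel; apply: etrans d_rel.
  by apply: eq_bigr => p _; rewrite /d1 mulrA.
have d1p0 : d1 p0 = 1 by rewrite /d1 divrr // divr_unit.
have d1_central p : d1 p \in central.
  apply/centralP => z; apply/eqP; rewrite eq_sym -subr_eq0; apply/eqP.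
  apply: (IHn (fun p => z * d1 p - d1 p * z)) => [|y].
    rewrite ltnS in lt_n; apply: leq_trans lt_n.
    rewrite (cardsD1 p0 [set p | d p != 0]) inE dp0 ltnS.
    apply: subset_leq_card; apply/fintype.subsetP => q; rewrite !inE => zq.
    apply/andP; split.
      by apply: contraNneq zq => ->; rewrite d1p0 mulr1 mul1r subrr.
    by apply: contraNneq zq => dq; rewrite /d1 dq !(mul0r, mulr0) subrr.
  transitivity (\sum_p e p * (y * z) * d1 p - (\sum_p e p * y * d1 p) * z).
    rewrite mulr_suml -sumrB; apply: eq_bigr => q _.
    by rewrite mulrBr !mulrA.
  by rewrite !rel1 mul0r subrr.
have := coord_eq (\row_p Centre (d1_central p)).
have -> : \sum_k \val ((\row_p Centre (d1_central p)) 0 k) * e k = 0.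
  rewrite -[RHS](rel1 1); apply: eq_bigr => p _.
  by rewrite mxE mulr1 (centralP _ (d1_central p)).
rewrite raddf0 => /rowP/(_ p0); rewrite !mxE => /(congr1 \val) /=.
by rewrite d1p0 => /eqP; rewrite eq_sym oner_eq0.
Qed.

(** The action on R of the element of the tensor product of H and its opposite
    ring that is the sum of the pure tensors listed in s. *)
Definition sandwich (R : nzRingType) (i : H -> R) (s : seq (H * H)) (y : R) : R :=
  \sum_(ab <- s) i ab.1 * y * i ab.2.

(** The tensor product of H and its opposite ring acts faithfully on H, by
    [basis_sandwich_free], so an operator that vanishes on H comes from the zero
    tensor, provided that the centre of H acts centrally on R. *)
Lemma sandwich_transfer (R : nzRingType) (i : {rmorphism H -> R}) s :
  (forall c (y : R), i (\val (c : centre H)) * y = y * i (\val c)) ->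
  (forall y, sandwich idfun s y = 0) -> forall y, sandwich i s y = 0.
Proof.
move=> ic s0 y; pose d p := \sum_(ab <- s) \val (coord ab.1 0 p) * ab.2.
have d0 p : d p = 0.
  apply: basis_sandwich_free p => z; rewrite -[RHS](s0 z) /sandwich /d.
  under eq_bigr do rewrite mulr_sumr.
  rewrite exchange_big; apply: eq_bigr => -[a b] _ /=.
  rewrite -{2}[a]coordK !mulr_suml; apply: eq_bigr => p _ /=.
  rewrite mulrA; congr (_ * _).
  by rewrite -[RHS]mulrA (centralP _ (valP (coord a 0 p)) (e p * z)).
transitivity (\sum_p i (e p) * y * i (d p)); last first.
  by apply: big1 => p _; rewrite d0 rmorph0 mulr0.
rewrite /sandwich /d; under [RHS]eq_bigr do rewrite rmorph_sum mulr_sumr.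
rewrite exchange_big; apply: eq_bigr => -[a b] _ /=.
rewrite -{1}[a]coordK rmorph_sum !mulr_suml; apply: eq_bigr => p _ /=.
by rewrite !rmorphM mulrA -!ic !mulrA.
Qed.

(** The m^2 maps y |-> e_p y e_q are linearly independent over the centre by
    [basis_sandwich_free], hence span all endomorphisms of the m-dimensional
    space H; [Theta] sends the coefficients of such a combination to its
    matrix. *)
Lemma coord_sandwich k :
  exists s, forall y, sandwich idfun s y = \val (coord y 0 k).
Proof.
pose Theta (t : 'M[centre H]_m) : 'M[centre H]_m :=
  \matrix_(r, l) \sum_p \sum_q t p q * coord (e p * e r * e q) 0 l.
have Theta_lin : linear Theta.
  move=> c t t'; apply/matrixP => r l; rewrite !mxE mulr_sumr -big_split /=.
  apply: eq_bigr => p _; rewrite mulr_sumr -big_split /=.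
  by apply: eq_bigr => q _; rewrite !mxE mulrDl mulrA.
pose Th : {linear 'M[centre H]_m -> 'M[centre H]_m} :=
  HB.pack Theta (GRing.isLinear.Build _ _ _ _ Theta Theta_lin).
pose op t y := \sum_p \sum_q \val ((t : 'M[centre H]_m) p q) * (e p * y * e q).
have ThetaE t r : row r (Theta t) = coord (op t (e r)).
  apply/rowP => l; rewrite !mxE raddf_sum summxE; apply: eq_bigr => p _.
  rewrite raddf_sum summxE; apply: eq_bigr => q _.
  by rewrite /= coordZ !mxE.
have op_row t y : op t y = \sum_r \val (coord y 0 r) * op t (e r).
  rewrite /op; under [RHS]eq_bigr do rewrite mulr_sumr.
  rewrite [RHS]exchange_big; apply: eq_bigr => p _ /=.
  under [RHS]eq_bigr do rewrite mulr_sumr.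
  rewrite [RHS]exchange_big; apply: eq_bigr => q _ /=.
  rewrite -{1}[y]coordK mulr_sumr mulr_suml mulr_sumr; apply: eq_bigr => r _.
  rewrite !mulrA; do 2 congr (_ * _).
  by rewrite -!(centralP _ (valP (coord y 0 r))) -!mulrA.
have Theta_unit : lin_mx Th \in unitmx.
  rewrite -row_free_unit -kermx_eq0; apply/eqP/row_matrixP => k0.
  rewrite row0; set w := row _ _.
  have : w *m lin_mx Th = 0 by rewrite /w -row_mul mulmx_ker row0.
  rewrite mul_rV_lin => /(canRL mxvecK); rewrite linear0 /= => Tw0.
  set t := vec_mx w in Tw0.
  have opt0 y : op t y = 0.
    rewrite op_row big1 // => r _.
    have : row r (Theta t) = 0 by rewrite Tw0 row0.
    rewrite ThetaE => c0; rewrite -[op t _]coordK big1 ?mulr0 // => l _.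
    by rewrite c0 mxE rmorph0 mul0r.
  have t0 : t = 0.
    apply/matrixP => p q; rewrite mxE.
    have dp0 : \sum_q \val (t p q) * e q = 0.
      apply: (@basis_sandwich_free (fun p => \sum_q \val (t p q) * e q)) => y.
      rewrite -[RHS](opt0 y); apply: eq_bigr => p' _; rewrite mulr_sumr.
      apply: eq_bigr => q' _.
      by rewrite !mulrA -(centralP _ (valP (t p' q')) (e p' * y)) !mulrA.
    have := coord_eq (row p t); under eq_bigr do rewrite mxE.
    by rewrite dp0 raddf0 => /rowP/(_ q); rewrite !mxE.
  by rewrite -[w]vec_mxK -/t t0 linear0.
pose D : 'M[centre H]_m := \matrix_(r, l) ((r == k)%:R * coord 1 0 l).
pose t := vec_mx (mxvec D *m invmx (lin_mx Th)).
have ThtD : Theta t = D.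
  have : mxvec (Th t) = mxvec D by rewrite -mul_vec_lin /t vec_mxK mulmxKV.
  by move/(canRL mxvecK); rewrite mxvecK.
have opt r : op t (e r) = (r == k)%:R.
  have : row r (Theta t) = (r == k)%:R *: coord 1.
    by rewrite ThtD; apply/rowP => l; rewrite !mxE.
  rewrite ThetaE -coordZ => /(congr1 (fun v : 'rV_m => \sum_l \val (v 0 l) * e l)).
  by rewrite !coordK mulr1 rmorph_nat.
exists [seq (\val (t p q) * e p, e q) | p <- enum 'I_m, q <- enum 'I_m] => y.
rewrite /sandwich big_allpairs_dep big_enum /=.
transitivity (op t y).
  apply: eq_bigr => p _; rewrite big_enum; apply: eq_bigr => q _ /=.
  by rewrite !mulrA.
rewrite op_row (bigD1 k) //= opt eqxx mulr1 big1 ?addr0 // => r rk.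
by rewrite opt (negPf rk) mulr0.
Qed.

End Basis.

(** * Base change from the centre of H *)

Section BaseChange.
Variables (H : divRingType) (m : nat) (e : 'I_m -> H).

(** L is the tensor product of H and l over the centre of H, where [i] and [z]
    are the two inclusions and l is an extension of the centre via [j].  The
    uniqueness of coordinates with respect to [e] replaces the universal
    property. *)
Definition base_change (L : nzRingType) (l : fieldType) (i : {rmorphism H -> L})
    (z : {rmorphism l -> L}) (j : centre H -> l) : Prop :=
  [/\ forall c, z (j c) = i (\val c),
      forall c y, z c * y = y * z c
    & forall y, exists! v : 'rV[l]_m, y = \sum_k z (v 0 k) * i (e k)].

Section Coordinates.
Variables (L : nzRingType) (l : fieldType) (i : {rmorphism H -> L}).
Variables (z : {rmorphism l -> L}) (j : centre H -> l).
Hypothesis Lz : base_change i z j.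

Lemma base_change_zmod : zmod_morphism j.
Proof.
case: Lz => zj _ _ x y; apply: (fmorph_inj z).
by rewrite rmorphB !zj !rmorphB.
Qed.

Lemma base_change_monoid : monoid_morphism j.
Proof.
by case: Lz => zj _ _; split=> [|x y]; apply: (fmorph_inj z);
   rewrite ?rmorphM ?zj ?rmorph1 // !rmorphM.
Qed.

Lemma base_change_inj (v w : 'rV[l]_m) :
  \sum_k z (v 0 k) * i (e k) = \sum_k z (w 0 k) * i (e k) -> v = w.
Proof.
case: Lz => _ _ /(_ (\sum_k z (v 0 k) * i (e k))) [u [_ uU]] vw.
by rewrite -(uU v erefl) -(uU w vw).
Qed.

Lemma base_change_ext (R : nzRingType) (f g : {rmorphism L -> R}) :
  (forall x, f (i x) = g (i x)) -> (forall c, f (z c) = g (z c)) -> f =1 g.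
Proof.
case: Lz => _ _ Lex fgi fgz y; have [v [-> _]] := Lex y.
by rewrite !rmorph_sum; apply: eq_bigr => k _; rewrite !rmorphM /= fgi fgz.
Qed.

End Coordinates.

Hypothesis e_basis : centre_basis e.

(** The map is y |-> sum of the k(c_p) e_p when y is the sum of the c_p e_p.  It
    is multiplicative because the structure constants of H lie in the centre of
    H, on which k is compatible with [j] and [j']. *)
Lemma base_change_map (L L' : nzRingType) (l l' : fieldType)
    (i : {rmorphism H -> L}) (z : {rmorphism l -> L}) (j : centre H -> l)
    (i' : {rmorphism H -> L'}) (z' : {rmorphism l' -> L'}) (j' : centre H -> l')
    (k : {rmorphism l -> l'}) :
    base_change i z j -> base_change i' z' j' -> (forall c, k (j c) = j' c) ->
  exists f : {rmorphism L -> L'},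
    (forall x, f (i x) = i' x) /\ forall c, f (z c) = z' (k c).
Proof.
move=> Lz L'z kj; have [zj zC Lex] := Lz; have [z'j z'C _] := L'z.
pose cd y := projT1 (cid (Lex y)).
have cdK y : y = \sum_p z (cd y 0 p) * i (e p) by rewrite /cd; case: cid => v [].
have cd_eq (v : 'rV[l]_m) : cd (\sum_p z (v 0 p) * i (e p)) = v.
  by apply: (base_change_inj Lz); rewrite -cdK.
pose f y := \sum_p z' (k (cd y 0 p)) * i' (e p).
have cdB x y : cd (x - y) = cd x - cd y.
  rewrite -[RHS]cd_eq [in LHS](cdK x) [in LHS](cdK y) -sumrB; congr cd.
  by apply: eq_bigr => p _; rewrite !mxE rmorphB mulrBl.
have fB : zmod_morphism f.
  move=> x y; rewrite /f cdB -sumrB; apply: eq_bigr => p _.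
  by rewrite !mxE !rmorphB mulrBl.
pose fA : {additive L -> L'} := HB.pack f (GRing.isZmodMorphism.Build _ _ f fB).
have f_sum (a : 'I_m -> L) : f (\sum_p a p) = \sum_p f (a p).
  exact: (raddf_sum fA).
have fz c y : f (z c * y) = z' (k c) * f y.
  rewrite {1}(cdK y) mulr_sumr {1}/f.
  have -> : \sum_p z c * (z (cd y 0 p) * i (e p)) =
            \sum_p z ((c *: cd y) 0 p) * i (e p).
    by apply: eq_bigr => q _; rewrite !mxE rmorphM mulrA.
  rewrite cd_eq /f mulr_sumr; apply: eq_bigr => p _.
  by rewrite !mxE !rmorphM mulrA.
have fi x : f (i x) = i' x.
  rewrite -[x in LHS](coordK e_basis) rmorph_sum.
  have -> : \sum_p i (\val (coord e_basis x 0 p) * e p) =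
            \sum_p z ((map_mx j (coord e_basis x)) 0 p) * i (e p).
    by apply: eq_bigr => q _; rewrite mxE rmorphM zj.
  rewrite /f cd_eq -[x in RHS](coordK e_basis) rmorph_sum.
  by apply: eq_bigr => q _; rewrite mxE rmorphM kj z'j.
have f1 : f 1 = 1 by rewrite -(rmorph1 i) fi rmorph1.
have fM : monoid_morphism f.
  split=> // x y.
  have fMi x' p : f (i x' * i (e p)) = f (i x') * f (i (e p)).
    by rewrite -rmorphM !fi rmorphM.
  rewrite [in LHS](cdK x) mulr_suml f_sum [f x in RHS]/f mulr_suml.
  apply: eq_bigr => p _ /=; rewrite -mulrA fz -mulrA; congr (_ * _).
  rewrite [in LHS](cdK y) mulr_sumr f_sum [f y in RHS]/f mulr_sumr.
  apply: eq_bigr => q _ /=.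
  by rewrite mulrA -zC -mulrA fz fMi !fi mulrA z'C mulrA.
pose fR : {rmorphism L -> L'} :=
  HB.pack f (GRing.isZmodMorphism.Build _ _ f fB)
    (GRing.isMonoidMorphism.Build _ _ f fM).
exists fR.
split=> // c.
by have := fz c 1; rewrite !mulr1 f1 mulr1.
Qed.

Section Centralising.
Variables (L : nzRingType) (l : fieldType) (i : {rmorphism H -> L}).
Variables (z : {rmorphism l -> L}) (j : centre H -> l).
Hypothesis Lz : base_change i z j.

(** Apply the r-th coordinate operator of H to y.  It is linear over l, so it
    gives the coordinate v_r of y, which lies in l; since y commutes with H, it
    also gives y multiplied by the r-th coordinate of 1.  Take r such that the
    latter is nonzero. *)
Lemma base_change_centraliser y :
  (forall x, y * i x = i x * y) -> exists c, y = z c.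
Proof.
move=> Cy; have [zj zC Lex] := Lz.
have [r ur] : exists r, coord e_basis 1 0 r != 0.
  apply: contrapT => no_r; have : (1 : H) != 0 by apply: oner_neq0.
  rewrite -[1](coordK e_basis) big1 ?eqxx // => k _.
  suff -> : coord e_basis 1 0 k = 0 by rewrite rmorph0 mul0r.
  by apply: contrapT => /eqP uk; apply: no_r; exists k.
have [s sE] := coord_sandwich e_basis r.
have [v [yE _]] := Lex y.
have sH x : sandwich i s (i x) = z (j (coord e_basis x 0 r)).
  rewrite zj -sE /sandwich rmorph_sum.
  by apply: eq_bigr => ab _; rewrite !rmorphM.
have s_left : sandwich i s y = z (v 0 r).
  rewrite yE /sandwich; under eq_bigr do rewrite mulr_sumr mulr_suml.
  rewrite exchange_big (bigD1 r) //= [X in _ + X]big1 => [|k kr].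
    rewrite addr0; transitivity (z (v 0 r) * sandwich i s (i (e r))).
      rewrite /sandwich mulr_sumr; apply: eq_bigr => ab _.
      by rewrite !mulrA -zC.
    have [j1 _] := base_change_monoid Lz.
    by rewrite sH coord_basis mxE !eqxx j1 rmorph1 mulr1.
  transitivity (z (v 0 k) * sandwich i s (i (e k))).
    rewrite /sandwich mulr_sumr; apply: eq_bigr => ab _.
    by rewrite !mulrA -zC.
  rewrite sH coord_basis mxE eqxx eq_sym (negPf kr) zj.
  by rewrite !rmorph0 mulr0.
have s_right : sandwich i s y = z (j (coord e_basis 1 0 r)) * y.
  rewrite -sH /sandwich mulr_suml; apply: eq_bigr => ab _.
  by rewrite rmorph1 mulr1 -!mulrA Cy.
exists ((j (coord e_basis 1 0 r))^-1 * v 0 r).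
have ju : j (coord e_basis 1 0 r) != 0.
  rewrite -(fmorph_eq0 z) zj.
  by rewrite (fmorph_eq0 (i \o \val : {rmorphism centre H -> L})).
by rewrite rmorphM -s_left s_right mulrA -rmorphM mulVf // rmorph1 mul1r.
Qed.

End Centralising.

End BaseChange.

(** * Automorphisms and base change *)

Lemma divring_rmorph_inj (D : divRingType) (R : nzRingType)
    (f : {rmorphism D -> R}) : injective f.
Proof.
move=> x y fxy; apply/eqP; rewrite -subr_eq0; apply: contraT => /divr_unit uxy.
have := oner_neq0 R.
by rewrite -(rmorph1 f) -(divrr uxy) rmorphM rmorphB fxy subrr mul0r eqxx.
Qed.

Section RelAutMorphism.
Variables (K L : nzRingType) (i : K -> L).

Fact relAut_zmod_morphism (s : relAut i) : zmod_morphism s.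
Proof. by case: (relAutP s). Qed.

Fact relAut_monoid_morphism (s : relAut i) : monoid_morphism s.
Proof. by case: (relAutP s). Qed.

HB.instance Definition _ (s : relAut i) :=
  GRing.isZmodMorphism.Build L L s (relAut_zmod_morphism s).
HB.instance Definition _ (s : relAut i) :=
  GRing.isMonoidMorphism.Build L L s (relAut_monoid_morphism s).

Lemma relAut_fix (s : relAut i) x : s (i x) = i x.
Proof. by case: (relAutP s). Qed.

Lemma relAut_inv_ex (s : relAut i) :
  exists t : relAut i, cancel s t /\ cancel t s.
Proof.
have [t tK] := relAutV_ex s; exists t; split=> // x.
by case: (relAutP s) => _ _ /bij_inj s_inj _; apply: s_inj; rewrite tK.
Qed.

End RelAutMorphism.

Section Automorphisms.
Variables (H : divRingType) (m : nat) (e : 'I_m -> H).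
Hypothesis e_basis : centre_basis e.
Variables (L : nzRingType) (l : fieldType) (i : {rmorphism H -> L}).
Variables (z : {rmorphism l -> L}) (j : centre H -> l).
Hypothesis Lz : base_change e i z j.

Definition restricts (s : relAut i) (sigma : relAut j) :=
  forall c, s (z c) = z (sigma c).

(** An automorphism of L/H preserves the centraliser of H, which is l. *)
Lemma restriction_ex s : exists sigma, restricts s sigma.
Proof.
have [zj zC _] := Lz.
have res_ex (t : relAut i) c : exists c', t (z c) = z c'.
  apply: (base_change_centraliser e_basis Lz) => x.
  by rewrite -(relAut_fix t x) -!rmorphM zC.
pose r t c := projT1 (cid (res_ex t c)).
have rE (t : relAut i) c : t (z c) = z (r t c) by rewrite /r; case: cid.
have [t [st ts]] := relAut_inv_ex s.
have rP : is_relAut j (r s).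
  split=> [x y||| x].
  - by apply: (fmorph_inj z); rewrite -rE !rmorphB /= !rE.
  - split=> [|x y]; apply: (fmorph_inj z); rewrite -rE; first by rewrite !rmorph1.
    by rewrite !rmorphM /= !rE.
  - by exists (r t) => x; apply: (fmorph_inj z); rewrite -!rE ?st ?ts.
  - by apply: (fmorph_inj z); rewrite -rE zj relAut_fix.
by exists (RelAut rP) => c; rewrite rE.
Qed.

Lemma extension_ex sigma : exists s, restricts s sigma.
Proof.
have ext (tau : relAut j) : exists f : {rmorphism L -> L},
    (forall x, f (i x) = i x) /\ forall c, f (z c) = z (tau c).
  exact: (base_change_map e_basis (k := tau) Lz Lz (relAut_fix tau)).
have [tau [st ts]] := relAut_inv_ex sigma.
have [f [fi fz]] := ext sigma; have [g [gi gz]] := ext tau.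
have fP : is_relAut i f.
  split=> //; first exact: rmorphB.
    by split=> [|x y]; rewrite ?rmorph1 ?rmorphM.
  exists g.
    apply: (base_change_ext Lz (f := g \o f) (g := idfun)) => x /=.
      by rewrite fi gi.
    by rewrite fz gz st.
  apply: (base_change_ext Lz (f := f \o g) (g := idfun)) => x /=.
    by rewrite gi fi.
  by rewrite gz fz ts.
by exists (RelAut fP).
Qed.

Lemma restricts_inj s s' sigma :
  restricts s sigma -> restricts s' sigma -> s = s'.
Proof.
move=> sE s'E; apply: relAut_inj; apply: (base_change_ext Lz) => [x|c].
  by rewrite /= !relAut_fix.
by rewrite /= sE s'E.
Qed.

Lemma restricts_fun s sigma sigma' :
  restricts s sigma -> restricts s sigma' -> sigma = sigma'.
Proof.
by move=> E E'; apply: relAut_inj => c; apply: (fmorph_inj z); rewrite -E E'.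
Qed.

Lemma restrictsM s s' sigma sigma' : restricts s sigma -> restricts s' sigma' ->
  restricts (s * s')%g (sigma * sigma')%g.
Proof. by move=> E E' c; rewrite /= E' E. Qed.

(** An element of l that is fixed by all automorphisms of l/h is fixed by those
    of L/H, hence lies in H and commutes with H.  Conversely, by uniqueness of
    coordinates, an element fixed by Aut(L/H) has coordinates fixed by
    Aut(l/h). *)
Lemma galois_base_change : galois i <-> galois j.
Proof.
have [zj zC Lex] := Lz; split=> -[_ _ fix_i]; split.
- exact: base_change_zmod Lz.
- exact: base_change_monoid Lz.
- move=> c fc; have [s|x zx] := fix_i (z c).
    by have [sigma ->] := restriction_ex s; rewrite fc.
  have xC : x \in @central H.
    apply/centralP => y; apply: (@divring_rmorph_inj _ _ i).
    by rewrite !rmorphM -zx zC.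
  by exists (Centre xC); apply: (fmorph_inj z); rewrite zj.
- exact: rmorphB.
- by split=> [|x y]; rewrite ?rmorph1 ?rmorphM.
move=> y fy; have [v [yE _]] := Lex y.
have v_fix k : exists x, v 0 k = j x.
  apply: fix_i => sigma; have [s sE] := extension_ex sigma.
  suff : v = \row_q sigma (v 0 q) by move=> /rowP/(_ k); rewrite mxE.
  apply: (base_change_inj Lz); rewrite -yE -[LHS](fy s) [in LHS]yE rmorph_sum.
  by apply: eq_bigr => q _; rewrite mxE rmorphM /= sE relAut_fix.
pose u k := projT1 (cid (v_fix k)).
exists (\sum_k \val (u k) * e k); rewrite yE rmorph_sum; apply: eq_bigr => k _.
by rewrite rmorphM -zj /u; case: cid => x /= <-.
Qed.

Lemma base_change_aut :
  exists (res : relAut i -> relAut j) (ext : relAut j -> relAut i),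
  [/\ (forall (s : relAut i) c, s (z c) = z (res s c)) /\
        {morph res : s t / (s * t)%g},
      (forall (sigma : relAut j) c, ext sigma (z c) = z (sigma c)) /\
        {morph ext : s t / (s * t)%g},
      cancel res ext & cancel ext res].
Proof.
have [res resP] := choice restriction_ex.
have [ext extP] := choice extension_ex.
exists res, ext; split; first split=> // s t.
- by apply: restricts_fun (resP _) (restrictsM (resP s) (resP t)).
- split=> // s t.
  by apply: restricts_inj (extP _) (restrictsM (extP s) (extP t)).
- by move=> s; apply: restricts_inj (extP _) (resP s).
- by move=> s; apply: restricts_fun (resP _) (extP s).
Qed.

End Automorphisms.

(** The centre of H commutes with H, so it is central in L by
    [centraliser_central], and identities between two-sided multiplications
    transfer from H to L.  This applies to two properties of the coordinate
    operators: their values commute with H, hence are central in L, and every y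
    is the sum of its coordinates times the e_k. *)
Lemma finite_aut_base_change (H L : divRingType) (m : nat) (e : 'I_m -> H)
    (e_basis : centre_basis e) (i : {rmorphism H -> L}) (G : finType)
    (alpha : G -> relAut i) :
  (forall s, exists g, alpha g = s) ->
  base_change e i (\val : {rmorphism centre L -> L}) (centre_map i).
Proof.
move=> alpha_surj.
have CC c := @centraliser_central _ _ i _ _ e_basis _ _ alpha_surj c.
have ih c : i (\val (c : centre H)) \in @central L.
  by apply: CC => x; rewrite -!(rmorphM i) (centralP _ (valP c)).
have icC c y : i (\val (c : centre H)) * y = y * i (\val c).
  exact: (centralP _ (ih c)).
have [s sE] := choice (coord_sandwich e_basis).
have sC k y : sandwich i (s k) y \in @central L.
  apply: CC => x; apply/eqP; rewrite eq_sym -subr_eq0; apply/eqP.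
  pose s' := [seq (x * ab.1, ab.2) | ab <- s k] ++
             [seq (- ab.1, ab.2 * x) | ab <- s k].
  have s'E (R : nzRingType) (f : {rmorphism H -> R}) w :
      sandwich f s' w = f x * sandwich f (s k) w - sandwich f (s k) w * f x.
    rewrite /sandwich big_cat !big_map mulr_sumr mulr_suml -sumrN /=.
    congr (_ + _); apply: eq_bigr => ab _; rewrite !(rmorphM, rmorphN) ?mulrA //.
    by rewrite !mulNr ?mulrA.
  rewrite -s'E; apply: (sandwich_transfer e_basis icC) => w.
  by rewrite (s'E H idfun) /= !sE (centralP _ (valP (coord e_basis w 0 k))) subrr.
have sK y : y = \sum_k sandwich i (s k) y * i (e k).
  pose s' := (1, 1) ::
    flatten [seq [seq (- ab.1, ab.2 * e k) | ab <- s k] | k <- enum 'I_m].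
  have s'E (R : nzRingType) (f : {rmorphism H -> R}) w :
      sandwich f s' w = w - \sum_k sandwich f (s k) w * f (e k).
    rewrite /sandwich big_cons big_flatten big_map big_enum rmorph1 mul1r mulr1 /=.
    rewrite -sumrN; congr (_ + _); apply: eq_bigr => k _; rewrite big_map.
    rewrite mulr_suml -sumrN; apply: eq_bigr => ab _.
    by rewrite !(rmorphM, rmorphN) !mulNr mulrA.
  apply/eqP; rewrite -subr_eq0; apply/eqP.
  rewrite -s'E; apply: (sandwich_transfer e_basis icC) => w.
  rewrite (s'E H idfun) -[w in X in X - _](coordK e_basis) -sumrB big1 // => k _.
  by rewrite /= sE subrr.
split.
- move=> c; rewrite /centre_map /insubd.
  by case: insubP => [u _ /= ->//|]; rewrite ih.
- by move=> c y; apply: (centralP _ (valP c)).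
move=> y; exists (\row_k Centre (sC k y)); split.
  by rewrite [LHS]sK; apply: eq_bigr => k _; rewrite mxE.
move=> v yE; apply/rowP => k; rewrite mxE; apply: val_inj => /=.
rewrite yE /sandwich; under eq_bigr do rewrite mulr_sumr mulr_suml.
rewrite exchange_big /=.
transitivity (\sum_q \val (v 0 q) * sandwich i (s k) (i (e q))).
  apply: eq_bigr => q _; rewrite /sandwich mulr_sumr; apply: eq_bigr => ab _.
  by rewrite !mulrA (centralP _ (valP (v 0 q)) (i ab.1)).
have sH x : sandwich i (s k) (i x) = i (\val (coord e_basis x 0 k)).
  rewrite -sE /sandwich rmorph_sum.
  by apply: eq_bigr => ab _; rewrite !rmorphM.
rewrite (bigD1 k) //= big1 => [|q qk]; rewrite sH coord_basis mxE eqxx.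
  by rewrite eqxx rmorph1 mulr1 addr0.
by rewrite eq_sym (negPf qk) rmorph0 mulr0.
Qed.

(** * The reduced norm form and the regular representation *)

Section RowBlocks.
Variables (R : comNzRingType) (n : nat).

(** Concatenates the rows of a matrix.  Unlike with [mxvec], the recursion on
    the number of rows makes right multiplication by A visibly block diagonal
    ([vec_rows_mul]). *)
Fixpoint vec_rows k : 'M[R]_(k, n) -> 'rV[R]_(k * n) :=
  if k is k'.+1 then
    fun M : 'M_(1 + k', n) => row_mx (usubmx M) (vec_rows (dsubmx M))
  else fun=> 0.

Fixpoint unvec_rows k : 'rV[R]_(k * n) -> 'M[R]_(k, n) :=
  if k is k'.+1 then
    fun v : 'rV_(n + k' * n) => col_mx (lsubmx v) (unvec_rows (rsubmx v))
  else fun=> 0.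

Fixpoint diag_blocks (A : 'M[R]_n) k : 'M[R]_(k * n) :=
  if k is k'.+1 then block_mx A 0 0 (diag_blocks A k') else 0.

Lemma unvec_rowsK k : cancel (@unvec_rows k) (@vec_rows k).
Proof.
elim: k => [|k IHk] v /=; first by apply/rowP => -[].
by rewrite col_mxKu col_mxKd IHk hsubmxK.
Qed.

Lemma vec_rowsK k : cancel (@vec_rows k) (@unvec_rows k).
Proof.
elim: k => [|k IHk] M /=; first by apply/matrixP => -[].
by rewrite row_mxKl row_mxKr IHk (@vsubmxK _ 1 k).
Qed.

Lemma vec_rows_linear k : linear (@vec_rows k).
Proof.
elim: k => [|k IHk] c M N /=; first by rewrite scaler0 addr0.
by rewrite !linearP /= IHk -add_row_mx -scale_row_mx.
Qed.

HB.instance Definition _ k :=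
  GRing.isLinear.Build R 'M_(k, n) 'rV_(k * n) _
    (@vec_rows k) (@vec_rows_linear k).

Lemma vec_rows_mul k (M : 'M_(k, n)) A :
  vec_rows (M *m A) = vec_rows M *m diag_blocks A k.
Proof.
elim: k M => [|k IHk] M /=; first by rewrite mul0mx.
rewrite mul_row_block !mulmx0 addr0 add0r -IHk.
by rewrite -(@mul_usub_mx _ 1 k) -(@mul_dsub_mx _ 1 k).
Qed.

Lemma det_diag_blocks A k : \det (diag_blocks A k) = \det A ^+ k.
Proof. by elim: k => [|k IHk] /=; rewrite ?det_mx00 // det_ublock IHk exprS. Qed.

End RowBlocks.

Lemma map_vec_rows (R S : comNzRingType) (f : {rmorphism R -> S}) n k
    (M : 'M[R]_(k, n)) :
  map_mx f (vec_rows M) = vec_rows (map_mx f M).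
Proof.
elim: k M => [|k IHk] M /=; first by apply/rowP => -[].
by rewrite map_row_mx IHk (@map_usubmx _ _ _ 1 k) (@map_dsubmx _ _ _ 1 k).
Qed.

(** Conjugate matrices have equal determinants; the two index sizes are not
    syntactically equal, and their equality comes from the ranks of P. *)
Lemma det_basis_change (d : fieldType) (S : comUnitRingType)
    (f : {rmorphism d -> S}) (p q : nat) (P : 'M[d]_(p, q))
    (A : 'M[S]_p) (B : 'M[S]_q) :
  row_free P -> row_full P -> A *m map_mx f P = map_mx f P *m B -> \det A = \det B.
Proof.
move=> /eqP Pp /eqP Pq; have pq : p = q by rewrite -Pp.
subst q => AB; have uP : P \in unitmx by rewrite -row_free_unit; apply/eqP.
have ufP : \det (map_mx f P) \is a GRing.unit by rewrite det_map_mx rmorph_unit.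
apply: (mulIr ufP); rewrite -det_mulmx AB det_mulmx.
exact: mulrC.
Qed.

Section ReducedNorm.
Variables (H : divRingType) (m : nat) (e : 'I_m -> H).
Hypothesis e_basis : centre_basis e.
Local Notation coord := (coord e_basis).

(** The matrix of right multiplication by x.  As matrices act on row vectors
    from the right, this is a morphism, not an antimorphism, of rings. *)
Definition regmx (x : H) : 'M[centre H]_m := \matrix_k coord (e k * x).

Lemma coord_mul y x : coord (y * x) = coord y *m regmx x.
Proof.
rewrite -{1}[y](coordK e_basis) mulr_suml raddf_sum; apply/rowP => l.
rewrite summxE mxE; apply: eq_bigr => k _ /=.
by rewrite -mulrA coordZ !mxE.
Qed.

Fact regmx_zmod_morphism : zmod_morphism regmx.
Proof.
move=> x y; apply/row_matrixP => k.
by rewrite linearB /= !rowK mulrBr raddfB.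
Qed.

Fact regmx_monoid_morphism : monoid_morphism regmx.
Proof.
split=> [|x y]; apply/row_matrixP => k.
  by rewrite rowK mulr1 coord_basis rowE mulmx1.
by rewrite rowK mulrA coord_mul row_mul rowK.
Qed.

HB.instance Definition _ :=
  GRing.isZmodMorphism.Build H 'M_m regmx regmx_zmod_morphism.
HB.instance Definition _ :=
  GRing.isMonoidMorphism.Build H 'M_m regmx regmx_monoid_morphism.

Section Splitting.
Variables (d : fieldType) (eta : {rmorphism centre H -> d}) (n : nat).
Variable psi : {rmorphism H -> 'M[d]_n}.
Hypothesis psi_split : splitting eta psi.

(** The balancing condition at x = 1 says that [psi] sends the centre to scalar
    matrices. *)
Lemma splitting_coord x : psi x = \sum_k eta (coord x 0 k) *: psi (e k).
Proof.
have [[_ _ bal] _] := psi_split.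
have psi_c c : psi (\val c) = (eta c)%:M.
  have := bal 1 c 1; rewrite mul1r mulr1 scale1r => ->.
  by rewrite rmorph1 scalemx1.
rewrite -{1}[x](coordK e_basis) rmorph_sum; apply: eq_bigr => k _.
by rewrite rmorphM psi_c /= -mul_scalar_mx.
Qed.

Definition split_basis : 'M[d]_(m, n * n) := \matrix_k vec_rows (psi (e k)).

Let comb (v : 'rV[d]_m) := \sum_k v 0 k *: psi (e k).

Let comb_mx v : vec_rows (comb v) = v *m split_basis.
Proof.
rewrite /comb linear_sum mulmx_sum_row; apply: eq_bigr => k _.
by rewrite linearZ rowK.
Qed.

(** The balanced map (x, s) |-> s coord(x) factors through M_n(d) by a map g, by
    the universal property.  That comb is a left inverse of g is the uniqueness
    part of the universal property of (x, s) |-> s psi(x). *)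
Let comb_bij : exists g, cancel comb g /\ cancel g comb.
Proof.
have [bal univ] := psi_split.
pose b x s : 'rV[d]_m := \row_k (eta (coord x 0 k) * s).
have b_bal : balanced eta b.
  split=> [x y s|x s t|x c s]; apply/rowP => k; rewrite !mxE.
  - by rewrite raddfD !mxE rmorphD mulrDl.
  - by rewrite mulrDr.
  by rewrite -(centralP _ (valP c)) coordZ mxE rmorphM mulrA (mulrC (eta c)).
have [g [[gB gE] _]] := univ _ b b_bal.
pose gA : {additive 'M[d]_n -> 'rV[d]_m} :=
  HB.pack g (GRing.isZmodMorphism.Build _ _ g gB).
exists g; split=> [v|].
  have -> : g (comb v) = \sum_k g (v 0 k *: psi (e k)) by apply: (raddf_sum gA).
  apply/rowP => l; rewrite summxE (bigD1 l) //= big1 => [|k kl].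
    by rewrite gE !mxE coord_basis mxE !eqxx rmorph1 mul1r addr0.
  by rewrite gE !mxE coord_basis mxE eqxx eq_sym (negPf kl) rmorph0 mul0r.
have [id_ [_ idU]] := univ _ _ bal.
have combg : id_ = comb \o g.
  apply: idU; split=> [M N|x s] /=.
    rewrite gB /comb -sumrB; apply: eq_bigr => k _.
    by rewrite !mxE scalerBl.
  rewrite gE [psi x]splitting_coord /comb scaler_sumr; apply: eq_bigr => k _.
  by rewrite mxE scalerA mulrC.
have idid : id_ = idfun by apply: idU.
by move=> M; rewrite -[LHS]/((comb \o g) M) -combg idid.
Qed.

Lemma regmx_split_basis x :
  map_mx eta (regmx x) *m split_basis = \matrix_k vec_rows (psi (e k) *m psi x).
Proof.
apply/row_matrixP => k; rewrite row_mul -map_row !rowK -comb_mx.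
congr vec_rows; transitivity (psi (e k * x)); last by rewrite rmorphM.
by rewrite splitting_coord; apply: eq_bigr => l _; rewrite mxE.
Qed.

Lemma split_basis_free : row_free split_basis.
Proof.
have [g [combK _]] := comb_bij.
rewrite -kermx_eq0; apply/eqP/row_matrixP => k; rewrite row0; set w := row _ _.
have : vec_rows (comb w) = 0 by rewrite comb_mx /w -row_mul mulmx_ker row0.
move=> /(canRL (@vec_rowsK _ _ _)) cw0; rewrite -[w]combK cw0.
have -> : unvec_rows (0 : 'rV[d]_(n * n)) = comb 0 :> 'M_n.
  by apply: (can_inj (@vec_rowsK _ _ _)); rewrite unvec_rowsK comb_mx mul0mx.
by rewrite combK.
Qed.

Lemma split_basis_full : row_full split_basis.
Proof.
have [g [_ gK]] := comb_bij.
rewrite -sub1mx; apply/row_subP => k; set w := row _ _.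
rewrite -[w]unvec_rowsK -[unvec_rows w]gK comb_mx.
exact: submxMl.
Qed.

End Splitting.

Definition generic_regmx : 'M[{mpoly (centre H)[m]}]_m :=
  \sum_k 'X_k *: map_mx (@mpolyC m (centre H)) (regmx (e k)).

Lemma basis_gt0 : (0 < m)%N.
Proof.
case: (posnP m) => // m0; have := oner_neq0 H.
rewrite -[1](coordK e_basis) big1 ?eqxx // => k.
by have := ltn_ord k; rewrite {2}m0.
Qed.

(** Over a splitting field d, the rows of [split_basis] are a basis of M_n(d) in
    which right multiplication by x = sum of the X_k e_k has matrix
    [generic_regmx], whereas in the standard basis it is n diagonal copies of
    psi(x).  So its determinant is the n-th power of the reduced norm; as the
    centre of H embeds into d, the identity holds over the centre. *)
Lemma reduced_norm_regular (F : {mpoly (centre H)[m]}) :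
  reduced_norm_form e F -> exists2 n, (0 < n)%N & F ^+ n = \det generic_regmx.
Proof.
case=> n [d [eta [psi [psi_split FE]]]]; exists n.
  have /eqP Pm := split_basis_free psi_split.
  have /eqP Pn := split_basis_full psi_split.
  by have := basis_gt0; rewrite -Pm Pn; case: (n).
have map_inj : injective (map_mpoly eta : {mpoly (centre H)[m]} -> {mpoly d[m]}).
  move=> p q /mpolyP pq; apply/mpolyP => mon; apply: (fmorph_inj eta).
  by rewrite -!mcoeff_map_mpoly pq.
apply: map_inj; rewrite rmorphXn /= FE -det_diag_blocks -det_map_mx.
apply/esym.
apply: (det_basis_change (f := @mpolyC m d) (P := split_basis psi))
  (split_basis_free psi_split) (split_basis_full psi_split) _.
apply/row_matrixP => k; rewrite !row_mul.
have rowP k' : row k' (split_basis psi) = vec_rows (psi (e k')) by rewrite rowK.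
rewrite -[in RHS]map_row rowP map_vec_rows -vec_rows_mul mulmx_sumr linear_sum.
rewrite -row_mul /generic_regmx raddf_sum mulmx_suml linear_sum.
apply: eq_bigr => q _ /=.
rewrite -scalemxAr linearZ /=.
rewrite map_mxZ /= [map_mpoly _ _]map_mpolyX -scalemxAl linearZ; congr (_ *: _).
have -> : map_mx (map_mpoly eta) (map_mx (@mpolyC m _) (regmx (e q))) =
          map_mx (@mpolyC m _) (map_mx eta (regmx (e q))).
  by apply/matrixP => a b; rewrite !mxE map_mpolyC.
rewrite -map_mxM regmx_split_basis //= -map_row rowK map_vec_rows.
by rewrite map_mxM.
Qed.

End ReducedNorm.

Section NormEvaluation.
Variables (H : divRingType) (m : nat) (e : 'I_m -> H).
Hypothesis e_basis : centre_basis e.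
Variable N : {mpoly (centre H)[m]}.
Hypothesis N_form : reduced_norm_form e N.

Lemma reduced_norm_eq0 (f : fieldType) (j : {rmorphism centre H -> f})
    (v : 'I_m -> f) :
  (mmap j v N == 0) = (\det (\sum_k v k *: map_mx j (regmx e_basis (e k))) == 0).
Proof.
have [n n0 NE] := reduced_norm_regular e_basis N_form.
have -> : (mmap j v N == 0) = (mmap j v N ^+ n == 0) by rewrite expf_eq0 n0.
rewrite -rmorphXn /= NE -det_map_mx; congr (\det _ == 0).
rewrite raddf_sum; apply: eq_bigr => k _ /=.
rewrite map_mxZ /= mmapX mmap1U; congr (_ *: _).
by apply/matrixP => a b; rewrite !mxE mmapC.
Qed.

(** A zero v of the form makes right multiplication by the element y of
    coordinates v singular: w y = 0 for some nonzero w in L, so that y = 0. *)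
Lemma base_change_trivial_zero (L : divRingType) (l : fieldType)
    (i : {rmorphism H -> L}) (z : {rmorphism l -> L}) (j : centre H -> l) :
  base_change e i z j -> only_trivial_zero j N.
Proof.
move=> Lz; have [zj zC _] := Lz.
pose jr : {rmorphism centre H -> l} :=
  HB.pack j (GRing.isZmodMorphism.Build _ _ j (base_change_zmod Lz))
    (GRing.isMonoidMorphism.Build _ _ j (base_change_monoid Lz)).
move=> v /eqP; rewrite (reduced_norm_eq0 jr) => /det0P[w w0 wv].
pose y (a : 'rV[l]_m) := \sum_k z (a 0 k) * i (e k).
have y0 : y 0 = 0 by apply: big1 => k _; rewrite mxE rmorph0 mul0r.
have yw : y w * y (\row_k v k) = 0.
  transitivity (\sum_p \sum_q \sum_r
      z (w 0 p * (v q * j (coord e_basis (e p * e q) 0 r))) * i (e r)).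
    rewrite mulr_suml; apply: eq_bigr => p _; rewrite mulr_sumr.
    apply: eq_bigr => q _.
    rewrite mxE -mulrA (mulrA (i _)) -zC -mulrA -rmorphM.
    rewrite -[e p * e q in LHS](coordK e_basis) rmorph_sum !mulr_sumr.
    apply: eq_bigr => r _.
    by rewrite !rmorphM zj !mulrA.
  rewrite -[RHS]y0 -wv /y.
  transitivity (\sum_r \sum_p \sum_q
      z (w 0 p * (v q * j (coord e_basis (e p * e q) 0 r))) * i (e r)).
    rewrite exchange_big /=; under eq_bigr do rewrite exchange_big /=.
    rewrite exchange_big /=; apply: eq_bigr => r _.
    by rewrite exchange_big.
  apply: eq_bigr => r _; rewrite mxE rmorph_sum mulr_suml.
  apply: eq_bigr => p _; rewrite summxE mulr_sumr rmorph_sum mulr_suml.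
  by apply: eq_bigr => q _; rewrite !mxE.
have [yv|yv] := eqVneq (y (\row_k v k)) 0; last first.
  have := divr_neq0 _ yv; move/(_ (y w)); rewrite yw eqxx => yw0.
  case/negP: w0; apply/eqP/(base_change_inj Lz); rewrite -/(y w) -/(y 0) y0.
  by apply/eqP; apply: contraT => /yw0.
move=> k; have : \row_k v k = 0.
  by apply: (base_change_inj Lz); rewrite -/(y (\row_k v k)) -/(y 0) y0.
by move/rowP/(_ k); rewrite !mxE.
Qed.

End NormEvaluation.

(** * Scalar extensions of H that are division rings *)

Section ScalarExtension.
Variables (H : divRingType) (m : nat) (e : 'I_m.+1 -> H).
Hypothesis e_basis : centre_basis e.
Variables (f : fieldType) (j : {rmorphism centre H -> f}).
Local Notation coord := (coord e_basis).

Definition regmx_ext (x : H) : 'M[f]_m.+1 := map_mx j (regmx e_basis x).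

Fact regmx_ext_zmod_morphism : zmod_morphism regmx_ext.
Proof. by move=> x y; rewrite /regmx_ext raddfB map_mxB. Qed.

Fact regmx_ext_monoid_morphism : monoid_morphism regmx_ext.
Proof.
split=> [|x y]; rewrite /regmx_ext; first by rewrite rmorph1 map_mx1.
by rewrite rmorphM map_mxM.
Qed.

HB.instance Definition _ :=
  GRing.isZmodMorphism.Build H 'M[f]_m.+1 regmx_ext regmx_ext_zmod_morphism.
HB.instance Definition _ :=
  GRing.isMonoidMorphism.Build H 'M[f]_m.+1 regmx_ext regmx_ext_monoid_morphism.

Definition ext_comb (v : 'rV[f]_m.+1) : 'M[f]_m.+1 :=
  \sum_k v 0 k *: regmx_ext (e k).

Definition ext_span : {pred 'M[f]_m.+1} :=
  fun M => `[< exists v, M = ext_comb v >].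

Lemma ext_spanP M : reflect (exists v, M = ext_comb v) (M \in ext_span).
Proof. exact: asboolP. Qed.

Lemma ext_comb_linear : linear ext_comb.
Proof.
move=> c v w; rewrite /ext_comb scaler_sumr -big_split; apply: eq_bigr => k _ /=.
by rewrite !mxE scalerDl scalerA.
Qed.

HB.instance Definition _ :=
  GRing.isLinear.Build f 'rV[f]_m.+1 'M[f]_m.+1 _ ext_comb ext_comb_linear.

Lemma regmx_ext_comb x : regmx_ext x = ext_comb (map_mx j (coord x)).
Proof.
rewrite -{1}[x](coordK e_basis) raddf_sum; apply: eq_bigr => k _.
apply/row_matrixP => r; rewrite mxE linearZ /= -!map_row !rowK.
by rewrite mulrA -(centralP _ (valP (coord x 0 k))) -mulrA coordZ map_mxZ.
Qed.

(** An element is recovered from its right multiplication by applying the latter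
    to 1. *)
Lemma row1_ext_comb v : map_mx j (coord 1) *m ext_comb v = v.
Proof.
rewrite /ext_comb mulmx_sumr [RHS]row_sum_delta; apply: eq_bigr => k _.
rewrite -scalemxAr -map_mxM -coord_mul mul1r coord_basis.
by rewrite map_delta_mx.
Qed.

Lemma ext_spanM M N : M \in ext_span -> N \in ext_span -> M * N \in ext_span.
Proof.
move=> /ext_spanP[v ->] /ext_spanP[w ->]; apply/ext_spanP.
exists (\sum_k \sum_l (v 0 k * w 0 l) *: map_mx j (coord (e k * e l))).
rewrite mulr_suml raddf_sum; apply: eq_bigr => k _.
rewrite mulr_sumr raddf_sum; apply: eq_bigr => l _ /=.
by rewrite linearZ /= -regmx_ext_comb rmorphM -scalerAl -scalerAr scalerA.
Qed.

Lemma ext_span1 : 1 \in ext_span.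
Proof.
by apply/ext_spanP; exists (map_mx j (coord 1)); rewrite -regmx_ext_comb rmorph1.
Qed.

Fact ext_span_divring_closed : divring_closed ext_span.
Proof.
split=> [|M N /ext_spanP[v ->] /ext_spanP[w ->]|M N MS NS].
- exact: ext_span1.
- by apply/ext_spanP; exists (v - w); rewrite raddfB.
apply: ext_spanM => //.
have [uN|/invr_out->//] := boolP (N \is a GRing.unit).
(* The candidate inverse is the element b = 1 N^-1 of the span; b N and 1 agree
   at 1, hence everywhere. *)
pose b := map_mx j (coord 1) *m N^-1.
have bS : ext_comb b \in ext_span by apply/ext_spanP; exists b.
suff <- : ext_comb b = N^-1 by [].
apply: (mulIr uN); rewrite mulVr //.
have /ext_spanP[c bN] := ext_spanM bS NS.
have := row1_ext_comb c; rewrite -bN mulmxA row1_ext_comb /b -mulmxA.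
rewrite [N^-1 *m N]mulVr // mulmx1 => cE.
by rewrite bN -cE -regmx_ext_comb rmorph1.
Qed.

HB.instance Definition _ :=
  GRing.isDivringClosed.Build 'M[f]_m.+1 ext_span ext_span_divring_closed.

(** The tensor product of H and f over the centre of H, realised as a ring of
    matrices through its regular representation. *)
Record scalar_ext := ScalarExt { ext_val : 'M[f]_m.+1; _ : ext_val \in ext_span }.

HB.instance Definition _ := [isSub of scalar_ext for ext_val].
HB.instance Definition _ := [Choice of scalar_ext by <:].
HB.instance Definition _ := [SubChoice_isSubUnitRing of scalar_ext by <:].

Lemma scalar_ext_base_change : exists (i : {rmorphism H -> scalar_ext})
  (z : {rmorphism f -> scalar_ext}), base_change e i z j.
Proof.
have iS x : regmx_ext x \in ext_span.
  by apply/ext_spanP; rewrite regmx_ext_comb; exists (map_mx j (coord x)).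
have zS c : c%:M \in ext_span.
  apply/ext_spanP; exists (c *: map_mx j (coord 1)).
  by rewrite linearZ /= -regmx_ext_comb rmorph1 scalemx1.
pose i x := ScalarExt (iS x); pose z c := ScalarExt (zS c).
have iB : zmod_morphism i by move=> x y; apply: val_inj; rewrite /= raddfB.
have iM : monoid_morphism i.
  by split=> [|x y]; apply: val_inj; rewrite /= ?rmorph1 ?rmorphM.
have zB : zmod_morphism z by move=> x y; apply: val_inj; rewrite /= raddfB.
have zM : monoid_morphism z.
  by split=> [|x y]; apply: val_inj; rewrite /= ?scalar_mxM.
pose ir : {rmorphism H -> scalar_ext} :=
  HB.pack i (GRing.isZmodMorphism.Build _ _ i iB)
    (GRing.isMonoidMorphism.Build _ _ i iM).
pose zr : {rmorphism f -> scalar_ext} :=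
  HB.pack z (GRing.isZmodMorphism.Build _ _ z zB)
    (GRing.isMonoidMorphism.Build _ _ z zM).
exists ir, zr.
have combE (v : 'rV[f]_m.+1) : \val (\sum_k zr (v 0 k) * ir (e k)) = ext_comb v.
  rewrite raddf_sum; apply: eq_bigr => k _ /=.
  exact: mul_scalar_mx.
split.
- move=> c; apply: val_inj => /=; rewrite -map_scalar_mx; congr map_mx.
  apply/row_matrixP => k; rewrite rowK -(centralP _ (valP c)) coordZ coord_basis.
  by rewrite -scalemx1 linearZ /= row1.
- by move=> c y; apply: val_inj; apply: esym (scalar_mxC _ _).
move=> [M MS]; have /ext_spanP[v ME] := MS.
exists v; split; first by apply: val_inj; rewrite combE.
move=> w /(congr1 \val); rewrite combE /= ME => vw.
by rewrite -(row1_ext_comb v) vw row1_ext_comb.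
Qed.

Lemma scalar_ext_division (N : {mpoly (centre H)[m.+1]}) :
  reduced_norm_form e N -> only_trivial_zero j N ->
  forall y : scalar_ext, y != 0 -> y \is a GRing.unit.
Proof.
move=> N_form N_zero [M MS] M0.
have /ext_spanP[v ME] := MS.
have uM : M \is a GRing.unit.
  rewrite -[_ \is a _]/(M \in unitmx) unitmxE unitfE ME.
  have := reduced_norm_eq0 e_basis N_form j (v 0).
  rewrite -/(ext_comb v) => <-; apply: contra M0 => /eqP /N_zero v0.
  apply/eqP/val_inj; rewrite /= ME; apply: big1 => k _.
  by rewrite v0 scale0r.
have VS : M^-1 \in ext_span by rewrite rpredV.
apply/unitrP; exists (ScalarExt VS).
by split; apply: val_inj; rewrite /= ?mulVr ?mulrV.
Qed.

End ScalarExtension.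

Lemma base_change_division_ex (H : divRingType) (m : nat) (e : 'I_m -> H)
    (e_basis : centre_basis e) (N : {mpoly (centre H)[m]})
    (f : fieldType) (j : {rmorphism centre H -> f}) :
    reduced_norm_form e N -> only_trivial_zero j N ->
  exists (F : divRingType) (i : {rmorphism H -> F}) (z : {rmorphism f -> F}),
    base_change e i z j.
Proof.
case: m => [|m] in e e_basis N *; first by have := basis_gt0 e_basis.
move=> N_form N_zero.
pose F : divRingType := HB.pack (scalar_ext e_basis j)
  (UnitRing_isDivisionRing.Build _ (scalar_ext_division N_form N_zero)).
have [i [z iz]] := scalar_ext_base_change e_basis j.
by exists F, i, z.
Qed.

(** * Embedding problems *)

Theorem mainTheorem1 (H : divRingType) (m : nat) (e : 'I_m -> H)
    (e_basis : centre_basis e)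
    (F_H : {mpoly (centre H)[m]}) (F_H_form : reduced_norm_form e F_H)
    (L : divRingType) (iota : {rmorphism H -> L})
    (G : finGroupType) (alpha : G -> relAut iota)
    (alpha_ep : embedding_problem alpha) :
  (exists (F : divRingType) (kappa : {rmorphism L -> F})
          (beta : relAut (kappa \o iota) -> G),
      solution alpha beta)
  <->
  (exists (f : fieldType) (kappa : {rmorphism centre L -> f})
          (beta : relAut (kappa \o centre_map iota) -> G),
      solution (check alpha) beta /\
      only_trivial_zero (kappa \o centre_map iota) F_H).
Proof.
have [_ _ alpha_surj] := alpha_ep.
have Lz := finite_aut_base_change e_basis alpha_surj.
have [iota_c _ _] := Lz.
split=> [[F [kappa [beta [F_gal betaM beta_bij beta_res]]]]|].
  pose i : {rmorphism H -> F} := kappa \o iota.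
  have [beta' beta'K betaK] := beta_bij.
  have Fz0 : base_change e i (\val : {rmorphism centre F -> F}) (centre_map i).
    apply: (@finite_aut_base_change _ _ _ _ e_basis i G beta') => s.
    by exists (beta s); apply: beta'K.
  have [_ valC F_ex] := Fz0.
  (* The centre of L commutes with H, so it is mapped into the centre of F. *)
  have kappa_c c : kappa (\val (c : centre L)) \in @central F.
    have [x|c' ->] := base_change_centraliser e_basis Fz0 (y := kappa (\val c)).
      by rewrite /= -!(rmorphM kappa) (centralP _ (valP c)).
    exact: valP.
  pose kc c := Centre (kappa_c c).
  have kcB : zmod_morphism kc by move=> x y; apply: val_inj; rewrite /= !rmorphB.
  have kcM : monoid_morphism kc.
    by split=> [|x y]; apply: val_inj; rewrite /= ?rmorph1 ?rmorphM.
  pose k : {rmorphism centre L -> centre F} :=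
    HB.pack kc (GRing.isZmodMorphism.Build _ _ kc kcB)
      (GRing.isMonoidMorphism.Build _ _ kc kcM).
  have Fz : base_change e i (\val : {rmorphism centre F -> F})
      (k \o centre_map iota).
    by split=> // c /=; rewrite -iota_c.
  have [res [ext [[resP resM] [extP extM] resK extK]]] :=
    base_change_aut e_basis Fz.
  exists (centre F), k, (beta \o ext); split.
    split=> [|s t||sigma x].
    - exact: (galois_base_change e_basis Fz).1 F_gal.
    - by rewrite /= extM betaM.
    - by apply: bij_comp beta_bij _; exists res.
    apply: val_inj; rewrite /= beta_res; exact: (extP sigma (kc x)).
  exact (base_change_trivial_zero e_basis F_H_form Fz).
case=> f [kappa [beta [[f_gal betaM beta_bij beta_res] F_H_zero]]].
have [jB jM _] := f_gal.
pose j : {rmorphism centre H -> f} :=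
  HB.pack (kappa \o centre_map iota)
    (GRing.isZmodMorphism.Build _ _ (kappa \o centre_map iota) jB)
    (GRing.isMonoidMorphism.Build _ _ (kappa \o centre_map iota) jM).
(* Here F is the base change of H to f; L embeds into it by functoriality. *)
have [F [i [z Fz0]]] :=
  @base_change_division_ex _ _ _ e_basis _ _ j F_H_form F_H_zero.
have [k [ki kz]] :=
  base_change_map e_basis (k := kappa) Lz Fz0 (fun c => erefl).
have [zj zC F_ex] := Fz0.
have Fz : base_change e (k \o iota : {rmorphism H -> F}) z
    (kappa \o centre_map iota).
  split=> // [c|y]; first by rewrite /= ki -zj.
  have [v [yE vU]] := F_ex y.
  exists v; split=> [|w]; first by rewrite yE; apply: eq_bigr => q _; rewrite /= ki.
  move=> wE; apply: vU; rewrite wE; apply: eq_bigr => q _.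
  by rewrite /= ki.
have [res [ext [[resP resM] [extP extM] resK extK]]] :=
    base_change_aut e_basis Fz.
exists F, k, (beta \o res); split=> [|s t||s x].
- exact: (galois_base_change e_basis Fz).2 f_gal.
- by rewrite /= resM betaM.
- by apply: bij_comp beta_bij _; exists ext.
(* Both sides are ring morphisms on L, which is generated by H and its centre. *)
apply: (base_change_ext Lz (f := k \o alpha (beta (res s)))
  (g := s \o k)) => [y|c] /=.
  by rewrite relAut_fix [RHS](relAut_fix s).
have -> : alpha (beta (res s)) (\val c) =
          \val (check alpha (beta (res s)) c) by [].
by rewrite !kz beta_res [RHS]resP.
Qed.
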